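(* Let $(\mathfrak{g},[-,-]_{\mathfrak{g}},P)$ and $(\mathfrak{g}^{*},[-,-]_{\mathfrak{g}^{*}},Q^{*})$ be Rota-Baxter Lie algebras of weight zero (with $P,Q:\mathfrak g\to\mathfrak g$ linear) such that $Q$ is admissible to $(\mathfrak{g},[-,-]_{\mathfrak{g}},P)$ and $P^{*}$ is admissible to $(\mathfrak{g}^{*},[-,-]_{\mathfrak{g}^{*}},Q^{*})$. Let $(\mathfrak{g},\circ_{\mathfrak{g}})$ and $(\mathfrak{g}^{*},\circ_{\mathfrak{g}^{*}})$ be the induced pre-Lie algebras, $x\circ_{\mathfrak g}y=[P(x),y]_{\mathfrak g}$ and $a^*\circ_{\mathfrak g^*}b^*=[Q^*(a^* ),b^*]_{\mathfrak g^*}$, and let $(\mathfrak{g},\triangleright_{\mathfrak{g}},\triangleleft_{\mathfrak{g}})$ and $(\mathfrak{g}^{*},\triangleright_{\mathfrak{g}^{*}},\triangleleft_{\mathfrak{g}^{*}})$ be the compatible special L-dendriform algebras of these pre-Lie algebras defined by $$x\triangleleft_{\mathfrak{g}}y=-Q([x,y]_{\mathfrak{g}}),\quad x\triangleright_{\mathfrak{g}} y=x\circ_{\mathfrak{g}}y-x\triangleleft_{\mathfrak{g}}y,\quad a^{*}\triangleleft_{\mathfrak{g}^{*}}b^{*}=-P^{*}([a^{*}, b^{*}]_{\mathfrak{g}^{*}}), \quad a^{*}\triangleright_{\mathfrak{g}^{*}}b^{*}=a^{*}\circ_{\mathfrak{g}^{*}}b^{*}-a^{*}\triangleleft_{\mathfrak{g}^{*}}b^{*}.$$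 If $((\mathfrak{g},P),(\mathfrak{g}^{*},Q^{*}),\mathrm{ad}^{*}_{\mathfrak{g}},\mathrm{ad}^{*}_{\mathfrak{g}^{*}})$ is a matched pair of Rota-Baxter Lie algebras of weight zero, then $(\mathfrak{g},\mathfrak{g}^{*},\mathcal{L}^{*}_{\circ_{\mathfrak{g}}},\mathcal{L}^{*}_{\triangleleft_{\mathfrak{g}}},\mathcal{L}^{*}_{\circ_{\mathfrak{g}^{*}}},\mathcal{L}^{*}_{\triangleleft_{\mathfrak{g}^{*}}})$ is a matched pair of pre-Lie algebras.
   Context: All vector spaces and algebras are finite-dimensional over a field of characteristic zero. $T^*$ denotes the transpose of a linear map $T$. For linear $\rho:A\to\mathrm{End}(V)$, $\rho^*:A\to\mathrm{End}(V^* )$ is defined by $\langle\rho^*(x)v^*,u\rangle=-\langle v^*,\rho(x)u\rangle$; $\mathfrak g^{**}$ is identified with $\mathfrak g$. $\mathrm{ad}(x)y=[x,y]$ and, for an operation $\cdot$, $\mathcal{L}_{\cdot}(x)y=x\cdot y$. A Rota-Baxter Lie algebra of weight zero is $(\mathfrak{g},[-,-],P)$ with $[P(x),P(y)]=P([x,P(y)])+P([P(x),y])$. A linear map $Q$ is admissible to it if $Q([P(x),y])-[P(x),Q(y)]-Q([x,Q(y)])=0$ for all $x,y$. A representation of $(\mathfrak{g},[-,-],P)$ (weight zero) is $(V,\rho,\alpha)$ with $(V,\rho)$ a Lie algebra representation and $\alpha:V\to V$ linear with $\rho(P(x))\alpha(v)=\alpha(\rho(P(x))v)+\alpha(\rho(x)\alpha(v))$.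 A matched pair of Lie algebras $(\mathfrak{g},\mathfrak{h},\rho_{\mathfrak g},\rho_{\mathfrak h})$: Lie algebras with representations $(\mathfrak{h},\rho_{\mathfrak g})$ of $\mathfrak{g}$ and $(\mathfrak{g},\rho_{\mathfrak h})$ of $\mathfrak{h}$ such that $\rho_{\mathfrak{g}}(x)[a,b]_{\mathfrak{h}}-[\rho_{\mathfrak{g}}(x)a,b]_{\mathfrak{h}}-[a,\rho_{\mathfrak{g}}(x)b]_{\mathfrak{h}}+\rho_{\mathfrak{g}}(\rho_{\mathfrak{h}}(a)x)b-\rho_{\mathfrak{g}}(\rho_{\mathfrak{h}}(b)x)a=0$ and $\rho_{\mathfrak{h}}(a)[x,y]_{\mathfrak{g}}-[\rho_{\mathfrak{h}}(a)x,y]_{\mathfrak{g}}-[x,\rho_{\mathfrak{h}}(a)y]_{\mathfrak{g}}+\rho_{\mathfrak{h}}(\rho_{\mathfrak{g}}(x)a)y-\rho_{\mathfrak{h}}(\rho_{\mathfrak{g}}(y)a)x=0$. A matched pair of Rota-Baxter Lie algebras $((\mathfrak{g},P_{\mathfrak g}),(\mathfrak{h},P_{\mathfrak h}),\rho_{\mathfrak g},\rho_{\mathfrak h})$: Rota-Baxter Lie algebras $(\mathfrak{g},P_{\mathfrak g})$, $(\mathfrak{h},P_{\mathfrak h})$ such that $(\mathfrak{h},\rho_{\mathfrak g},P_{\mathfrak h})$ and $(\mathfrak{g},\rho_{\mathfrak h},P_{\mathfrak g})$ are representations of $(\mathfrak{g},P_{\mathfrak g})$ and $(\mathfrak{h},P_{\mathfrak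 h})$ respectively and $(\mathfrak{g},\mathfrak{h},\rho_{\mathfrak g},\rho_{\mathfrak h})$ is a matched pair of Lie algebras. A pre-Lie algebra is $(A,\circ)$ with $(x\circ y)\circ z-x\circ(y\circ z)=(y\circ x)\circ z-y\circ(x\circ z)$; its sub-adjacent Lie bracket is $[x,y]=x\circ y-y\circ x$. A representation of $(A,\circ)$ is $(V,l,r)$ with $l,r:A\to\mathrm{End}(V)$ linear such that $l(x)l(y)v-l(x\circ y)v=l(y)l(x)v-l(y\circ x)v$ and $l(x)r(y)v-r(y)l(x)v=r(x\circ y)v-r(y)r(x)v$. An L-dendriform algebra $(A,\triangleright,\triangleleft)$ satisfies $(x\triangleright y)\triangleright z+(x\triangleleft y)\triangleright z+y\triangleright(x\triangleright z)-(y\triangleleft x)\triangleright z-(y\triangleright x)\triangleright z-x\triangleright(y\triangleright z)=0$ and $(x\triangleright y)\triangleleft z+y\triangleleft(x\triangleright z)+y\triangleleft(x\triangleleft z)-(y\triangleleft x)\triangleleft z-x\triangleright(y\triangleleft z)=0$; it is special if $\triangleleft$ is antisymmetric, and is compatible with the pre-Lie algebra $(A,\circ)$ if $x\circ y=x\triangleright y+x\triangleleft y$. A matched pair of pre-Lie algebras $(A,B,l_A,r_A,l_B,r_B)$ consists of pre-Lie algebras $(A,\circ_A),(B,\circ_B)$ with sub-adjacent brackets $[-,-]_A,[-,-]_B$ and linear maps $l_A,r_A:A\to\mathrm{End}(B)$, $l_B,r_B:B\to\mathrm{End}(A)$ such that $(B,l_A,r_A)$ is a representation of $(A,\circ_A)$,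 $(A,l_B,r_B)$ is a representation of $(B,\circ_B)$, and for all $x,y\in A$, $a,b\in B$: $l_{A}(x)(a\circ_{B}b)=-l_{A}(l_{B}(a)x-r_{B}(a)x)b+(l_{A}(x)a-r_{A}(x)a)\circ_{B}b+r_{A}(r_{B}(b)x)a+a\circ_{B}(l_{A}(x)b)$, $r_{A}(x)[a,b]_{B}=r_{A}(l_{B}(b)x)a-r_{A}(l_{B}(a)x)b+a\circ_{B}(r_{A}(x)b)-b\circ_{B}(r_{A}(x)a)$, $l_{B}(a)(x\circ_{A}y)=-l_{B}(l_{A}(x)a-r_{A}(x)a)y+(l_{B}(a)x-r_{B}(a)x)\circ_{A}y+r_{B}(r_{A}(y)a)x+x\circ_{A}(l_{B}(a)y)$, $r_{B}(a)[x,y]_{A}=r_{B}(l_{A}(y)a)x-r_{B}(l_{A}(x)a)y+x\circ_{A}(r_{B}(a)y)-y\circ_{A}(r_{B}(a)x)$. *)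

(* Defs.v *)
From HB Require Import structures.
From mathcomp Require Import all_boot all_order all_algebra.

Set Implicit Arguments.
Unset Strict Implicit.
Unset Printing Implicit Defensive.
Import GRing.Theory.
Local Open Scope ring_scope.

Section Dual.
Variable F : fieldType.
Implicit Types V W : vectType F.

Definition dual V : vectType F := Vector.clone F 'Hom(V, F^o) _.

Definition pairing V (f : dual V) (v : V) : F := (f : 'Hom(V, F^o)) v.

Lemma dualP V (f g : dual V) : pairing f =1 pairing g -> f = g.
Proof. by move=> fg; apply/lfunP. Qed.

Lemma pairing_linearl V (v : V) : scalar (fun f : dual V => pairing f v).
Proof. by move=> k f g; rewrite /pairing add_lfunE scale_lfunE. Qed.

Lemma pairing_linearr V (f : dual V) : scalar (pairing f).
Proof. by move=> k u v; rewrite /pairing linearP. Qed.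

Lemma pairing_sep V (u v : V) :
  (forall f : dual V, pairing f u = pairing f v) -> u = v.
Proof.
move=> euv; rewrite (coord_vbasis (memvf u)) (coord_vbasis (memvf v)).
apply: eq_bigr => i _; congr (_ *: _).
have := euv (linfun (coord (vbasis fullv) i : V -> F^o)).
by rewrite /pairing !lfunE.
Qed.

Definition precomp V W (T : 'Hom(V, W)) (f : dual W) : dual V :=
  ((f : 'Hom(W, F^o)) \o T)%VF.

Fact precomp_is_linear V W (T : 'Hom(V, W)) : linear (precomp T).
Proof.
move=> k f g; apply: dualP => v; rewrite pairing_linearl /pairing !comp_lfunE.
exact: pairing_linearl.
Qed.

HB.instance Definition _ V W (T : 'Hom(V, W)) :=
  GRing.isLinear.Build F (dual W) (dual V) *:%R (precomp T) (precomp_is_linear T).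

Definition transpose V W (T : 'Hom(V, W)) : 'Hom(dual W, dual V) :=
  linfun (precomp T).

Lemma transposeE V W (T : 'Hom(V, W)) (f : dual W) v :
  pairing (transpose T f) v = pairing f (T v).
Proof. by rewrite /pairing lfunE /= comp_lfunE. Qed.

Definition dual_rep (A : Type) V (rho : A -> 'End(V)) (x : A) : 'End(dual V) :=
  - transpose (rho x).

Lemma dual_repE (A : Type) V (rho : A -> 'End(V)) x (f : dual V) u :
  pairing (dual_rep rho x f) u = - pairing f (rho x u).
Proof. by rewrite /dual_rep opp_lfunE -transposeE /pairing opp_lfunE. Qed.

Definition bidual_fun V (v : V) : dual (dual V) :=
  linfun (fun f : dual V => pairing f v : F^o).

Lemma bidual_funE V (v : V) f : pairing (bidual_fun v) f = pairing f v.
Proof.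
pose h : {linear dual V -> F^o} :=
  HB.pack (fun f : dual V => pairing f v : F^o)
    (GRing.isLinear.Build F _ F^o *:%R _ (pairing_linearl v)).
exact: (lfunE h).
Qed.

Fact bidual_fun_is_linear V : linear (@bidual_fun V).
Proof.
move=> k u v; apply: dualP => f.
by rewrite pairing_linearl !bidual_funE pairing_linearr.
Qed.

HB.instance Definition _ V :=
  GRing.isLinear.Build F V (dual (dual V)) *:%R (@bidual_fun V)
    (@bidual_fun_is_linear V).

Definition bidual V : 'Hom(V, dual (dual V)) := linfun (@bidual_fun V).

Lemma bidualE V (v : V) f : pairing (bidual V v) f = pairing f v.
Proof. by rewrite lfunE /= bidual_funE. Qed.

Lemma bidual_ker V : lker (bidual V) == 0%VS.
Proof.
by apply/lker0P => u v euv; apply: pairing_sep => f; rewrite -(bidualE u) -(bidualE v) euv.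
Qed.

Lemma bidual_onto V : limg (bidual V) = fullv.
Proof.
apply/eqP; rewrite eqEdim subvf /= limg_dim_eq ?(eqP (bidual_ker V)) ?capv0 //.
by rewrite !dimvf /dim /= /dim /= !muln1.
Qed.

(* Transports an endomorphism of the bidual to V along the canonical map,
   which is bijective by bidual_ker and bidual_onto. *)
Definition unbidual V (T : 'End(dual (dual V))) : 'End(V) :=
  ((bidual V)^-1 \o T \o bidual V)%VF.

(* The dual representation of rho, moved from the bidual of V to V itself. *)
Definition predual_rep (A : Type) V (rho : A -> 'End(dual V)) (x : A) : 'End(V) :=
  unbidual (dual_rep rho x).

Lemma predual_repE (A : Type) V (rho : A -> 'End(dual V)) x (f : dual V) u :
  pairing f (predual_rep rho x u) = - pairing (rho x f) u.
Proof.
rewrite /predual_rep /unbidual !comp_lfunE -bidualE.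
by rewrite limg_lfunVK ?bidual_onto ?memvf // dual_repE bidualE.
Qed.

End Dual.

Section Algebras.
Variable F : fieldType.

Definition bilinear_op (A : vectType F) (op : A -> A -> A) : Prop :=
  bilinear_for *:%R *:%R op.

(* linfun is only meaningful for op x linear, e.g. under bilinear_op op. *)
Definition lmul (A : vectType F) (op : A -> A -> A) (x : A) : 'End(A) :=
  linfun (op x).

Lemma lmulE (A : vectType F) (op : A -> A -> A) (x y : A) :
  bilinear_op op -> lmul op x y = op x y.
Proof.
move=> [_ opr].
pose f : {linear A -> A} := HB.pack (op x) (GRing.isLinear.Build F _ _ *:%R _ (opr x)).
exact: (lfunE f).
Qed.

Definition ad (A : vectType F) (br : A -> A -> A) : A -> 'End(A) := lmul br.

Record lie_algebra (A : vectType F) (br : A -> A -> A) : Prop := LieAlgebra {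
  lie_bilinear : bilinear_op br;
  lie_alternating : forall x, br x x = 0;
  lie_jacobi : forall x y z,
    br x (br y z) + br y (br z x) + br z (br x y) = 0
}.

Record rota_baxter_lie (A : vectType F) (br : A -> A -> A) (P : 'End(A)) : Prop :=
  RotaBaxterLie {
  rb_lie : lie_algebra br;
  rb_eq : forall x y, br (P x) (P y) = P (br x (P y)) + P (br (P x) y)
}.

Definition admissible (A : vectType F) (br : A -> A -> A) (P Q : 'End(A)) : Prop :=
  forall x y, Q (br (P x) y) - br (P x) (Q y) - Q (br x (Q y)) = 0.

Record lie_rep (A V : vectType F) (br : A -> A -> A) (rho : A -> 'End(V)) : Prop :=
  LieRep {
  lie_rep_linear : linear rho;
  lie_rep_bracket : forall x y v,
    rho (br x y) v = rho x (rho y v) - rho y (rho x v)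
}.

Record rota_baxter_rep (A V : vectType F) (br : A -> A -> A) (P : 'End(A))
    (rho : A -> 'End(V)) (alpha : 'End(V)) : Prop := RotaBaxterRep {
  rb_rep_lie : lie_rep br rho;
  rb_rep_eq : forall x v,
    rho (P x) (alpha v) = alpha (rho (P x) v) + alpha (rho x (alpha v))
}.

Record lie_matched_pair (G H : vectType F) (brG : G -> G -> G) (brH : H -> H -> H)
    (rhoG : G -> 'End(H)) (rhoH : H -> 'End(G)) : Prop := LieMatchedPair {
  lmp_lieG : lie_algebra brG;
  lmp_lieH : lie_algebra brH;
  lmp_repG : lie_rep brG rhoG;
  lmp_repH : lie_rep brH rhoH;
  lmp_eqG : forall x a b,
    rhoG x (brH a b) - brH (rhoG x a) b - brH a (rhoG x b)
      + rhoG (rhoH a x) b - rhoG (rhoH b x) a = 0;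
  lmp_eqH : forall a x y,
    rhoH a (brG x y) - brG (rhoH a x) y - brG x (rhoH a y)
      + rhoH (rhoG x a) y - rhoH (rhoG y a) x = 0
}.

Record rota_baxter_matched_pair (G H : vectType F)
    (brG : G -> G -> G) (PG : 'End(G)) (brH : H -> H -> H) (PH : 'End(H))
    (rhoG : G -> 'End(H)) (rhoH : H -> 'End(G)) : Prop := RotaBaxterMatchedPair {
  rmp_rbG : rota_baxter_lie brG PG;
  rmp_rbH : rota_baxter_lie brH PH;
  rmp_repG : rota_baxter_rep brG PG rhoG PH;
  rmp_repH : rota_baxter_rep brH PH rhoH PG;
  rmp_lie : lie_matched_pair brG brH rhoG rhoH
}.

Record pre_lie_algebra (A : vectType F) (op : A -> A -> A) : Prop := PreLieAlgebra {
  pre_lie_bilinear : bilinear_op op;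
  pre_lie_eq : forall x y z,
    op (op x y) z - op x (op y z) = op (op y x) z - op y (op x z)
}.

Definition subadjacent (A : vectType F) (op : A -> A -> A) (x y : A) : A :=
  op x y - op y x.

Record pre_lie_rep (A V : vectType F) (op : A -> A -> A) (l r : A -> 'End(V)) : Prop :=
  PreLieRep {
  pre_lie_rep_linearl : linear l;
  pre_lie_rep_linearr : linear r;
  pre_lie_rep_eql : forall x y v,
    l x (l y v) - l (op x y) v = l y (l x v) - l (op y x) v;
  pre_lie_rep_eqr : forall x y v,
    l x (r y v) - r y (l x v) = r (op x y) v - r y (r x v)
}.

Record pre_lie_matched_pair (A B : vectType F)
    (opA : A -> A -> A) (opB : B -> B -> B)
    (lA rA : A -> 'End(B)) (lB rB : B -> 'End(A)) : Prop := PreLieMatchedPair {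
  pmp_preA : pre_lie_algebra opA;
  pmp_preB : pre_lie_algebra opB;
  pmp_repA : pre_lie_rep opA lA rA;
  pmp_repB : pre_lie_rep opB lB rB;
  pmp_eqlA : forall x a b,
    lA x (opB a b) = - lA (lB a x - rB a x) b + opB (lA x a - rA x a) b
                     + rA (rB b x) a + opB a (lA x b);
  pmp_eqrA : forall x a b,
    rA x (subadjacent opB a b) = rA (lB b x) a - rA (lB a x) b
                     + opB a (rA x b) - opB b (rA x a);
  pmp_eqlB : forall a x y,
    lB a (opA x y) = - lB (lA x a - rA x a) y + opA (lB a x - rB a x) y
                     + rB (rA y a) x + opA x (lB a y);
  pmp_eqrB : forall a x y,
    rB a (subadjacent opA x y) = rB (lA y a) x - rB (lA x a) y
                     + opA x (rB a y) - opA y (rB a x)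
}.

(* tr and tl stand for the operations written with a right- and a left-pointing
   triangle respectively. *)
Record l_dendriform (A : vectType F) (tr tl : A -> A -> A) : Prop := LDendriform {
  ldend_bilinearr : bilinear_op tr;
  ldend_bilinearl : bilinear_op tl;
  ldend_eq1 : forall x y z,
    tr (tr x y) z + tr (tl x y) z + tr y (tr x z)
      - tr (tl y x) z - tr (tr y x) z - tr x (tr y z) = 0;
  ldend_eq2 : forall x y z,
    tl (tr x y) z + tl y (tr x z) + tl y (tl x z)
      - tl (tl y x) z - tr x (tl y z) = 0
}.

Record special_l_dendriform (A : vectType F) (tr tl : A -> A -> A) : Prop :=
  SpecialLDendriform {
  special_ldend : l_dendriform tr tl;
  special_antisym : forall x y, tl x y = - tl y x
}.

Definition ldend_compatible (A : vectType F) (op tr tl : A -> A -> A) : Prop :=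
  forall x y, op x y = tr x y + tl x y.

Definition induced_pre_lie (A : vectType F) (br : A -> A -> A) (P : 'End(A))
  (x y : A) : A := br (P x) y.

Definition induced_tl (A : vectType F) (br : A -> A -> A) (Q : 'End(A))
  (x y : A) : A := - Q (br x y).

Definition induced_tr (A : vectType F) (br : A -> A -> A) (P Q : 'End(A))
  (x y : A) : A := induced_pre_lie br P x y - induced_tl br Q x y.

Section Induced.
Variables (A : vectType F) (br : A -> A -> A) (P Q : 'End(A)).
Hypothesis rbA : rota_baxter_lie br P.

Let bil : bilinear_op br := lie_bilinear (rb_lie rbA).

Let brDl x y z : br (x + y) z = br x z + br y z.
Proof. by have /= := bil.1 z 1 x y; rewrite !scale1r. Qed.
Let brDr x y z : br x (y + z) = br x y + br x z.
Proof. by have /= := bil.2 x 1 y z; rewrite !scale1r. Qed.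
Let brNl x z : br (- x) z = - br x z.
Proof.
have br0 : br 0 z = 0 by apply: (addrI (br 0 z)); rewrite -brDl !addr0.
by apply/eqP; rewrite -addr_eq0 -brDl addNr br0.
Qed.
Let brNr x z : br x (- z) = - br x z.
Proof.
have br0 : br x 0 = 0 by apply: (addrI (br x 0)); rewrite -brDr !addr0.
by apply/eqP; rewrite -addr_eq0 -brDr addNr br0.
Qed.
Let brC x y : br x y = - br y x.
Proof.
have := lie_alternating (rb_lie rbA) (x + y).
rewrite brDl !brDr !(lie_alternating (rb_lie rbA)) add0r addr0 => /eqP.
by rewrite addr_eq0 => /eqP.
Qed.
Let brJ x y z : br x (br y z) = br (br x y) z + br y (br x z).
Proof.
have /eqP := lie_jacobi (rb_lie rbA) x y z.
rewrite -addrA addr_eq0 => /eqP ->.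
by rewrite opprD [br y (br z x)]brC [br z (br x y)]brC [br z x]brC brNl !opprK
           [br y (br x z)]brC addrC.
Qed.

Lemma induced_pre_lieP : pre_lie_algebra (induced_pre_lie br P).
Proof.
split.
  by split=> x k u v; rewrite /induced_pre_lie /= ?linearP ?(bil.1 _ _ _ _) ?(bil.2 _ _ _ _).
move=> x y z; rewrite /induced_pre_lie [br (P x) (br _ z)]brJ (rb_eq rbA).
rewrite [br x _]brC linearN /= brDl brNl.
by rewrite [- _ + _]addrC -addrA opprD addNKr opprD opprK.
Qed.

Hypothesis admQ : admissible br P Q.

Lemma induced_ldend_compatible :
  ldend_compatible (induced_pre_lie br P) (induced_tr br P Q) (induced_tl br Q).
Proof. by move=> x y; rewrite /induced_tr subrK. Qed.

Let trE x y : induced_tr br P Q x y = br (P x) y + Q (br x y).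
Proof. by rewrite /induced_tr opprK. Qed.

Let trtrE x y z : induced_tr br P Q x (induced_tr br P Q y z) =
  br (P x) (br (P y) z) + Q (br (P x) (br y z) + br x (br (P y) z)).
Proof.
rewrite !trE !brDr !linearD /= -addrA; congr (_ + _).
have /eqP := admQ x (br y z); rewrite -addrA -opprD subr_eq0 => /eqP ->.
by rewrite addrA addrAC.
Qed.

Let tr_rep x y z :
  induced_tr br P Q x (induced_tr br P Q y z)
    - induced_tr br P Q y (induced_tr br P Q x z)
  = induced_tr br P Q (br (P x) y - br (P y) x) z.
Proof.
have PE : P (br (P x) y - br (P y) x) = br (P x) (P y).
  by rewrite linearB /= [br (P y) x]brC linearN opprK addrC -(rb_eq rbA).
have UV : br (P x) (br y z) + br x (br (P y) z)
        - (br (P y) (br x z) + br y (br (P x) z)) = br (br (P x) y - br (P y) x) z.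
  rewrite [br (P x) (br y z)]brJ [br x (br _ z)]brJ [br x (P y)]brC brDl.
  rewrite addrACA [br y _ + br (P y) _]addrC.
  by rewrite addrK.
rewrite !trtrE trE PE -UV linearB /= [br (P x) (br (P y) z)]brJ.
by rewrite opprD addrACA addrK.
Qed.

Lemma induced_special_l_dendriform :
  special_l_dendriform (induced_tr br P Q) (induced_tl br Q).
Proof.
have comp x y : induced_tr br P Q x y + induced_tl br Q x y = br (P x) y.
  by rewrite subrK.
have tlC x y : induced_tl br Q x y = - induced_tl br Q y x.
  by rewrite /induced_tl brC linearN.
have tlbil : bilinear_op (induced_tl br Q).
  split=> u k v w; rewrite /induced_tl /= ?(bil.1 _ _ _ _) ?(bil.2 _ _ _ _) /=.
    by rewrite linearP opprD scalerN.
  by rewrite linearP opprD scalerN.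
have trbil : bilinear_op (induced_tr br P Q).
  have [pl pr] := pre_lie_bilinear induced_pre_lieP.
  split=> u k v w; rewrite /induced_tr /=.
    by rewrite (pl _ _ _ _) (tlbil.1 _ _ _ _) /= scalerBr opprD addrACA.
  by rewrite (pr _ _ _ _) (tlbil.2 _ _ _ _) /= scalerBr opprD addrACA.
have trD u v w : induced_tr br P Q (u + v) w
    = induced_tr br P Q u w + induced_tr br P Q v w.
  by have /= := trbil.1 w 1 u v; rewrite !scale1r.
have trN u w : induced_tr br P Q (- u) w = - induced_tr br P Q u w.
  by rewrite !trE linearN /= !brNl linearN opprD.
split=> //; split=> // x y z.
  have -> (a1 a2 r1 b1 b2 r2 : A) :
      a1 + a2 + r1 - b1 - b2 - r2 = a1 + a2 - (b2 + b1) - (r2 - r1).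
    by rewrite opprB opprD !addrA (ACl (1*2*5*4*3*6)).
  by rewrite tr_rep -!trD !comp -trN -trD subrr.
have tlDr u v w : induced_tl br Q u (v + w) = induced_tl br Q u v + induced_tl br Q u w.
  by have /= := tlbil.2 u 1 v w; rewrite !scale1r.
have tlDl u v w : induced_tl br Q (u + v) w = induced_tl br Q u w + induced_tl br Q v w.
  by have /= := tlbil.1 w 1 u v; rewrite !scale1r.
have tlN u w : induced_tl br Q (- u) w = - induced_tl br Q u w.
  by rewrite /induced_tl brNl linearN.
rewrite -[_ + _ + induced_tl _ _ y _]addrA -tlDr comp [induced_tl br Q y x]tlC tlN opprK.
rewrite [X in X - _]addrAC -tlDl comp trE /induced_tl !brNr linearN /=.
have /eqP := admQ x (br y z); rewrite -addrA -opprD subr_eq0 => /eqP EQ.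
by rewrite -!opprD -EQ -linearD /= -brJ subrr oppr0.
Qed.

End Induced.

End Algebras.

(* Main.v *)
Require Import Defs.
From HB Require Import structures.
From mathcomp Require Import all_boot all_order all_algebra.

Set Implicit Arguments.
Unset Strict Implicit.
Unset Printing Implicit Defensive.
Import GRing.Theory.
Local Open Scope ring_scope.

(* The Rota-Baxter operator P + R on the bicrossed product of G and H induces
   the pre-Lie product u o v = [(P + R) u, v].  Its mixed components are
   x o b = rhoG(P x) b - rhoH(b)(P x) and a o y = rhoH(R a) y - rhoG(y)(R a),
   so the pre-Lie matched pair it splits into has l = rho o P and
   r(x) = - rho(x) o R.  For the coadjoint representations, these are the maps
   L*_o and L*_<|, since <a, Q [x, y]> = <Q^* a, [x, y]>. *)

Section LinearFacts.
Variables (F : fieldType) (U V : vectType F) (f : U -> V).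
Hypothesis linf : linear f.

Let f_lin : {linear U -> V} := HB.pack f (GRing.isLinear.Build F U V *:%R f linf).

Lemma linear_fun_additive : {morph f : x y / x + y}.
Proof. exact: (linearD f_lin). Qed.

Lemma linear_fun_opp : {morph f : x / - x}.
Proof. exact: (linearN f_lin). Qed.

Lemma linear_fun_sub : {morph f : x y / x - y}.
Proof. exact: (linearB f_lin). Qed.

End LinearFacts.

Section PairingFacts.
Variables (F : fieldType) (V : vectType F).

Lemma pairingNl (f : dual V) v : pairing (- f) v = - pairing f v.
Proof. exact: (linear_fun_opp (V := F^o) (pairing_linearl v)). Qed.

Lemma pairingNr (f : dual V) v : pairing f (- v) = - pairing f v.
Proof. exact: (linear_fun_opp (V := F^o) (pairing_linearr f)). Qed.

End PairingFacts.

Section LieFacts.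
Variables (F : fieldType) (A : vectType F) (br : A -> A -> A).
Hypothesis lieA : lie_algebra br.

Lemma lie_brDl x y z : br (x + y) z = br x z + br y z.
Proof. exact: (linear_fun_additive ((lie_bilinear lieA).1 z)). Qed.

Lemma lie_brDr x y z : br x (y + z) = br x y + br x z.
Proof. exact: (linear_fun_additive ((lie_bilinear lieA).2 x)). Qed.

Lemma lie_brNr x y : br x (- y) = - br x y.
Proof. exact: (linear_fun_opp ((lie_bilinear lieA).2 x)). Qed.

Lemma lie_brC x y : br x y = - br y x.
Proof.
have := lie_alternating lieA (x + y).
rewrite lie_brDl !lie_brDr !(lie_alternating lieA) add0r addr0 => /eqP.
by rewrite addr_eq0 => /eqP.
Qed.

(** By antisymmetry this is the Rota-Baxter identity: [P] is a homomorphism from the sub-adjacent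
    bracket to [br]. *)
Lemma rota_baxter_subadjacent (P : 'End(A)) x y : rota_baxter_lie br P ->
  P (subadjacent (induced_pre_lie br P) x y) = br (P x) (P y).
Proof.
move=> rbP; rewrite /subadjacent /induced_pre_lie [br (P y) x]lie_brC opprK.
by rewrite linearD addrC (rb_eq rbP).
Qed.

(** Supplies the linearity that [lmulE] requires to evaluate [lmul (induced_tl br Q)]. *)
Lemma induced_tl_bilinear (Q : 'End(A)) : bilinear_op (induced_tl br Q).
Proof.
have [brl brr] := lie_bilinear lieA.
split=> u k v w; rewrite /induced_tl /=.
  by rewrite (brl _ _ _ _) /= linearP opprD scalerN.
by rewrite (brr _ _ _ _) /= linearP opprD scalerN.
Qed.

End LieFacts.

Section InducedRep.
Variables (F : fieldType) (G V : vectType F) (br : G -> G -> G) (P : 'End(G)).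
Variables (rho : G -> 'End(V)) (R : 'End(V)) (l r : G -> 'End(V)).
Hypothesis rbP : rota_baxter_lie br P.
Hypothesis rep : rota_baxter_rep br P rho R.
Hypothesis lE : forall x v, l x v = rho (P x) v.
Hypothesis rE : forall x v, r x v = - rho x (R v).

Let rho_linear := lie_rep_linear (rb_rep_lie rep).

(** For [l], the commutator of [rho (P x)] and [rho (P y)] is [rho] at [[P x, P y]], which is [P] of
    the sub-adjacent bracket. For [r], expand [rho] at [[P x, y]] and apply the Rota-Baxter identity
    of [rep] under [rho y]. *)
Lemma induced_pre_lie_rep : pre_lie_rep (induced_pre_lie br P) l r.
Proof.
split.
- move=> k x y; apply/lfunP => v.
  by rewrite add_lfunE scale_lfunE !lE linearP rho_linear add_lfunE scale_lfunE.
- move=> k x y; apply/lfunP => v.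
  rewrite add_lfunE scale_lfunE !rE rho_linear add_lfunE scale_lfunE.
  by rewrite opprD scalerN.
- move=> x y v.
  have subr_swap (s t p q : V) : s - p = t - q -> s - t = p - q.
    move=> /eqP; rewrite subr_eq addrAC -addrA => /eqP ->.
    by rewrite addrAC subrr add0r.
  (* The swap collects the two composites of [l] into a commutator. *)
  apply: subr_swap; rewrite !lE -(lie_rep_bracket (rb_rep_lie rep)).
  rewrite -(rota_baxter_subadjacent (rb_lie rbP) _ _ rbP) linearB.
  by rewrite (linear_fun_sub rho_linear) add_lfunE opp_lfunE.
- move=> x y v; rewrite !lE !rE (linearN R) (linearN (rho (P x))) (linearN (rho y)) !opprK.
  rewrite (lie_rep_bracket (rb_rep_lie rep)) (rb_rep_eq rep) (linearD (rho y)) opprB.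
  by rewrite [RHS]addrAC addrK addrC.
Qed.

End InducedRep.

Lemma lie_matched_pair_sym (F : fieldType) (G H : vectType F)
    (brG : G -> G -> G) (brH : H -> H -> H)
    (rhoG : G -> 'End(H)) (rhoH : H -> 'End(G)) :
  lie_matched_pair brG brH rhoG rhoH -> lie_matched_pair brH brG rhoH rhoG.
Proof. by case. Qed.

(** Exchanging [G] and [H] turns the mixed equations for [G] into those for [H], so only the former
    need a proof. *)
Lemma rota_baxter_matched_pair_sym (F : fieldType) (G H : vectType F)
    (brG : G -> G -> G) (PG : 'End(G)) (brH : H -> H -> H) (PH : 'End(H))
    (rhoG : G -> 'End(H)) (rhoH : H -> 'End(G)) :
  rota_baxter_matched_pair brG PG brH PH rhoG rhoH ->
  rota_baxter_matched_pair brH PH brG PG rhoH rhoG.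
Proof. by case=> *; split=> //; apply: lie_matched_pair_sym. Qed.

Section InducedMatchedPairEquations.
Variables (F : fieldType) (G H : vectType F).
Variables (brG : G -> G -> G) (P : 'End(G)) (brH : H -> H -> H) (R : 'End(H)).
Variables (rhoG : G -> 'End(H)) (rhoH : H -> 'End(G)).
Variables (lG rG : G -> 'End(H)) (lH rH : H -> 'End(G)).
Hypothesis mp : rota_baxter_matched_pair brG P brH R rhoG rhoH.
Hypothesis lGE : forall x a, lG x a = rhoG (P x) a.
Hypothesis rGE : forall x a, rG x a = - rhoG x (R a).
Hypothesis lHE : forall a x, lH a x = rhoH (R a) x.
Hypothesis rHE : forall a x, rH a x = - rhoH a (P x).

Let opH := induced_pre_lie brH R.
Let lieH := lmp_lieH (rmp_lie mp).

Let rhoGN x a : rhoG (- x) a = - rhoG x a.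
Proof.
have rhoG_linear := lie_rep_linear (rb_rep_lie (rmp_repG mp)).
by rewrite (linear_fun_opp rhoG_linear) opp_lfunE.
Qed.

(** The last two terms measure how far [rhoG x] is from a derivation of [brH]. *)
Let derivation x a b : rhoG x (brH a b) =
  brH (rhoG x a) b + brH a (rhoG x b) - rhoG (rhoH a x) b + rhoG (rhoH b x) a.
Proof.
have /eqP := lmp_eqG (rmp_lie mp) x a b.
rewrite subr_eq0 => /eqP <-; rewrite -[_ - _ - _]addrA -opprD.
by rewrite -[RHS]addrA [_ - _ + rhoG (rhoH a x) b]addrC addKr subrKC.
Qed.

(** This is [derivation] at [P x], [R a], [b]. *)
Lemma induced_pre_lie_matched_eql x a b :
  lG x (opH a b) = - lG (lH a x - rH a x) b + opH (lG x a - rG x a) b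
                   + rG (rH b x) a + opH a (lG x b).
Proof.
rewrite /opH /induced_pre_lie !lGE !rGE lHE !rHE !opprK rhoGN opprK.
(* The differences [lH - rH] and [lG - rG] have become sums; their images under [P] and [R] are
   [rhoH (R a) (P x)] and [rhoG (P x) (R a)]. *)
rewrite (linearD P) (linearD R) -(rb_rep_eq (rmp_repG mp)) -(rb_rep_eq (rmp_repH mp)) derivation.
by rewrite (ACl (3*1*4*2)).
Qed.

(** This is [derivation] at [x], [R a], [R b], with the sign reversed. *)
Lemma induced_pre_lie_matched_eqr x a b :
  rG x (subadjacent opH a b) = rG (lH b x) a - rG (lH a x) b
                   + opH a (rG x b) - opH b (rG x a).
Proof.
rewrite !rGE (rota_baxter_subadjacent lieH _ _ (rmp_rbH mp)) !lHE derivation.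
rewrite /opH /induced_pre_lie !(lie_brNr lieH) !opprK [brH (R b) _](lie_brC lieH).
by rewrite !opprD opprK (ACl (4*3*2*1)).
Qed.

End InducedMatchedPairEquations.

(** The four maps are specified pointwise, so that dual multiplication operators can be used as they
    stand. *)
Lemma rota_baxter_matched_pair_pre_lie (F : fieldType) (G H : vectType F)
    (brG : G -> G -> G) (P : 'End(G)) (brH : H -> H -> H) (R : 'End(H))
    (rhoG lG rG : G -> 'End(H)) (rhoH lH rH : H -> 'End(G)) :
  rota_baxter_matched_pair brG P brH R rhoG rhoH ->
  (forall x a, lG x a = rhoG (P x) a) -> (forall x a, rG x a = - rhoG x (R a)) ->
  (forall a x, lH a x = rhoH (R a) x) -> (forall a x, rH a x = - rhoH a (P x)) ->
  pre_lie_matched_pair (induced_pre_lie brG P) (induced_pre_lie brH R) lG rG lH rH.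
Proof.
move=> mp lGE rGE lHE rHE; have mp' := rota_baxter_matched_pair_sym mp.
split.
- exact: induced_pre_lieP (rmp_rbG mp).
- exact: induced_pre_lieP (rmp_rbH mp).
- exact: induced_pre_lie_rep (rmp_rbG mp) (rmp_repG mp) lGE rGE.
- exact: induced_pre_lie_rep (rmp_rbH mp) (rmp_repH mp) lHE rHE.
- exact: induced_pre_lie_matched_eql mp lGE rGE lHE rHE.
- exact: induced_pre_lie_matched_eqr mp rGE lHE.
- exact: induced_pre_lie_matched_eql mp' lHE rHE lGE rGE.
- exact: induced_pre_lie_matched_eqr mp' rHE lGE.
Qed.

Theorem proposition3p16 (F : fieldType) (charF0 : [pchar F] =i pred0)
    (g : vectType F)
    (br : g -> g -> g) (brd : dual g -> dual g -> dual g) (P Q : 'End(g))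
    (rb_g : rota_baxter_lie br P)
    (rb_gd : rota_baxter_lie brd (transpose Q))
    (adm_g : admissible br P Q)
    (adm_gd : admissible brd (transpose Q) (transpose P))
    (mp : rota_baxter_matched_pair br P brd (transpose Q)
            (dual_rep (ad br)) (predual_rep (ad brd))) :
  pre_lie_matched_pair
    (induced_pre_lie br P) (induced_pre_lie brd (transpose Q))
    (dual_rep (lmul (induced_pre_lie br P)))
    (dual_rep (lmul (induced_tl br Q)))
    (predual_rep (lmul (induced_pre_lie brd (transpose Q))))
    (predual_rep (lmul (induced_tl brd (transpose P)))).
Proof.
have lie_g := rb_lie rb_g; have lie_gd := rb_lie rb_gd.
have bil := lie_bilinear lie_g; have bild := lie_bilinear lie_gd.
have op_bil := pre_lie_bilinear (induced_pre_lieP rb_g).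
have opd_bil := pre_lie_bilinear (induced_pre_lieP rb_gd).
apply: (rota_baxter_matched_pair_pre_lie mp) => [x a|x a|a x|a x].
- by apply: dualP => y; rewrite !dual_repE !lmulE.
(* Tested on [y], both sides equal the pairing of [a] with [Q [x, y]]. *)
- apply: dualP => y; rewrite pairingNl !dual_repE !lmulE //.
    by rewrite /induced_tl pairingNr transposeE.
  exact: induced_tl_bilinear.
- by apply: pairing_sep => f; rewrite !predual_repE !lmulE.
(* Elements of [g] are compared through functionals: against [f], both sides equal the pairing of
   [[a, f]] with [P x]. *)
- apply: pairing_sep => f; rewrite pairingNr !predual_repE !lmulE //.
    by rewrite /induced_tl pairingNl transposeE.
  exact: induced_tl_bilinear.
Qed.
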